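(* Let $k\ge 3$ and for $1\le a\le k$ let $\beta_{k,a}$ be the set partition of $[k]$ with the two blocks $[k]\setminus\{a\}$ and $\{a\}$. Then: (i) $\beta_{k,1}\sim\beta_{k,k}$; (ii) for all $n>k$ and all $2\le a\le k-1$ we have $|\Pi_n(\beta_{k,a+1})|\le|\Pi_n(\beta_{k,a})|$, with equality if $a<k-1$; consequently $\beta_{k,a}\sim\beta_{k,b}$ whenever $2\le a,b\le k-1$; (iii) $|\Pi_n(\beta_{k,k})|<|\Pi_n(\beta_{k,k-1})|$ for all $n\ge 2k-2$, and consequently $\beta_{k,k}\prec\beta_{k,a}$ for all $2\le a\le k-1$.
   Context: For a finite set $S$ of positive integers and a set partition $\sigma$ of $S$, the standardization of $\sigma$ is the set partition of $\{1,\dots,|S|\}$ obtained by replacing the $i$-th smallest element of $S$ by $i$. For $\sigma\vdash[n]$ and $\tau\vdash[k]$ ($k\le n$), $\sigma$ contains $\tau$ if there is $S\subseteq[n]$ such that the standardization of the restriction of $\sigma$ to $S$ (i.e. the partition of $S$ into the nonempty intersections of blocks of $\sigma$ with $S$) equals $\tau$; otherwise $\sigma$ avoids $\tau$. $\Pi_n(\tau)$ is the set of set partitions of $[n]=\{1,\dots,n\}$ avoiding $\tau$. For $\tau,\pi\vdash[k]$, $\tau\sim\pi$ (Wilf-equivalence) means $|\Pi_n(\tau)|=|\Pi_n(\pi)|$ for all $n>k$. We write $\tau\prec\pi$ if $|\Pi_n(\tau)|\le|\Pi_n(\pi)|$ for all $n>k$ and there exists $m\ge k$ such that $|\Pi_n(\tau)|<|\Pi_n(\pi)|$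 for all $n>m$. *)

(* Defs.v *)
From mathcomp Require Import all_boot.
Set Implicit Arguments.
Unset Strict Implicit.
Unset Printing Implicit Defensive.

(* The set [n] = {1, ..., n} is represented by 'I_n, the element i : 'I_n      *)
(* standing for the integer i.+1. A set partition of [n] is a                  *)
(* sigma : {set {set 'I_n}} such that partition sigma [set: 'I_n].             *)

Definition restriction (n : nat) (sigma : {set {set 'I_n}}) (S : {set 'I_n}) :
    {set {set 'I_n}} :=
  [set B :&: S | B in sigma] :\ set0.

(* enum_val lists the elements of S in increasing order, so that enum_val i,   *)
(* for i : 'I_#|S|, is the element of S that standardization replaces by i.    *)
Definition standardization (n : nat) (S : {set 'I_n})
    (P : {set {set 'I_n}}) : {set {set 'I_#|S|}} :=
  [set [set i : 'I_#|S| | enum_val i \in B] | B : {set 'I_n} in P].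

(* The two sides live a priori over different index types 'I_#|S| and 'I_k;    *)
(* the equality of the tagged values says that #|S| = k and that the           *)
(* standardization is tau.                                                     *)
Definition contains (n k : nat) (sigma : {set {set 'I_n}})
    (tau : {set {set 'I_k}}) : bool :=
  [exists S : {set 'I_n},
     Tagged (fun m => {set {set 'I_m}})
            (standardization S (restriction sigma S))
     == Tagged (fun m => {set {set 'I_m}}) tau].

Definition avoiders (n k : nat) (tau : {set {set 'I_k}}) :
    {set {set {set 'I_n}}} :=
  [set sigma | partition sigma [set: 'I_n] & ~~ contains sigma tau].

Definition wilf_equiv (k : nat) (tau pi : {set {set 'I_k}}) : Prop :=
  forall n, k < n -> #|avoiders n tau| = #|avoiders n pi|.

Definition wilf_prec (k : nat) (tau pi : {set {set 'I_k}}) : Prop :=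
  (forall n, k < n -> #|avoiders n tau| <= #|avoiders n pi|) /\
  (exists m, k <= m /\
     forall n, m < n -> #|avoiders n tau| < #|avoiders n pi|).

(* Here 1 <= a <= k is the integer itself, hence the comparison with i.+1.     *)
Definition beta (k a : nat) : {set {set 'I_k}} :=
  [set [set i : 'I_k | i.+1 != a]; [set i : 'I_k | i.+1 == a]].

Lemma beta_partition (k a : nat) :
  1 < k -> 0 < a <= k -> partition (beta k a) [set: 'I_k].
Proof.
move=> k_gt1 /andP[a_gt0 a_le]; pose A := [set i : 'I_k | i.+1 == a].
have -> : beta k a = [set ~: A; A].
  by congr [set _; _]; apply/setP=> i; rewrite !inE.
have A_neq0 : A != set0.
  have lt_a : a.-1 < k by rewrite prednK.
  by apply/set0Pn; exists (Ordinal lt_a); rewrite inE /= prednK.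
have AC_neq0 : ~: A != set0.
  have lt_b : (a == 1 : nat) < k by case: (a == 1) => //; apply: ltnW.
  apply/set0Pn; exists (Ordinal lt_b); rewrite !inE /=.
  by case: a a_gt0 {a_le A A_neq0 lt_b} => [|[|a]].
have trivA : [disjoint ~: A & A] by rewrite -setI_eq0 setIC setICr.
apply/and3P; split.
- apply/eqP/setP=> x; rewrite inE; apply/bigcupP.
  by have [xA|xA] := boolP (x \in A); [exists A | exists (~: A)];
    rewrite ?in_set2 ?eqxx ?orbT // inE.
- apply/trivIsetP=> B C /set2P[] -> /set2P[] ->; rewrite ?eqxx //.
  by rewrite disjoint_sym.
- by rewrite !inE negb_or eq_sym AC_neq0 eq_sym.
Qed.

(* Main.v *)
(* Write a partition of [n] as a word of length n whose letters are its       *)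
(* blocks. It avoids beta k a iff the word has no subword x^p y x^q with      *)
(* x != y, where p = a - 1 and q = k - a. For p, q > 0 this says that, for    *)
(* each letter x occurring m > d = k - 2 times, the occurrences of x number   *)
(* p to p + (m - d) are consecutive. Deleting the m - d last letters of this  *)
(* run loses only the multiplicity m - d, so the run can be rebuilt at any    *)
(* other place p' with 0 < p' <= d: this gives (ii). For a = k the surplus    *)
(* copies are those of a single letter and they end the word; moving them     *)
(* right after the d-th occurrence of that letter injects the avoiders of     *)
(* beta k k into those of beta k (k - 1), and misses every partition with two *)
(* blocks of size > d. Part (i) is reversal.                                  *)
Require Import Defs.
From mathcomp Require Import all_boot zify.
Set Implicit Arguments.
Unset Strict Implicit.
Unset Printing Implicit Defensive.

(** Each inequality between numbers of avoiders comes from an injection on words that commutes with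
    relabelling the letters; [leq_card_kernel] transfers it to partitions, and [contains_betaP] with
    [kernel_avoiders] translates avoidance of [beta k a] into [avoids (a - 1) (k - a)].

    Put d = k - 2, and let m be the multiplicity of a letter x. By [avoids_contiguous], a word that
    avoids x^p y x^q with p + q = d + 1 and p, q > 0 has, right after the p-th copy of x, m - d
    further copies in a row. [slide] deletes these copies and reinserts them after the p'-th copy.
    It preserves multiplicities, and deletion undoes insertion ([stretchK]), so the image determines
    the squeezed word, from which an avoider is rebuilt ([squeezeK], [slide_inj]).

    For a = k the surplus is a constant tail ([avoids_tail]), recovered from the multiplicities
    ([slide_inj_tail]). At most one letter then has more than d copies ([avoids_last_uniq]), so
    [avoids_two_letters] exhibits a missed word once n >= 2k - 2. *)

(** * Avoidance in words as contiguity of runs *)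

Definition avoids (T : eqType) (p q : nat) (w : seq T) : Prop :=
  forall v y v' x, w = v ++ y :: v' ->
    p <= count_mem x v -> q <= count_mem x v' -> x = y.

(** The run lengths [e] are a parameter, since inductions over prefixes must keep the excess of the
    whole word. *)
Definition contiguous (T : eqType) (p : nat) (e : T -> nat) (w : seq T) : Prop :=
  forall v y v' x, w = v ++ y :: v' -> p <= count_mem x v < p + e x -> x = y.

Definition excess (T : eqType) (d : nat) (w : seq T) (x : T) : nat :=
  count_mem x w - d.

(** For y != x all copies of x lie in v or v', so at least q of them in v' means at most m - q in v,
    where m is the multiplicity of x. *)
Lemma avoids_contiguous (T : eqType) p q d (w : seq T) :
  p + q = d.+1 -> avoids p q w <-> contiguous p (excess d w) w.
Proof.
move=> pqd; split=> w_av v y v' x def_w; have [//|neq] := eqVneq x y.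
  move=> h; apply: (w_av v y v' x def_w); move: h;
    rewrite /excess def_w count_cat /= eq_sym (negPf neq); lia.
move=> h h'; apply: (w_av v y v' x def_w); move: h h';
  rewrite /excess def_w count_cat /= eq_sym (negPf neq); lia.
Qed.

Lemma contiguous_rcons (T : eqType) p e (w : seq T) z :
  contiguous p e (rcons w z) <->
  contiguous p e w /\ forall x, p <= count_mem x w < p + e x -> x = z.
Proof.
split=> [cw | [cw cz] v y v' x].
  split=> [v y v' x def_w | x]; last by apply: (cw w z [::]); rewrite cats1.
  by apply: (cw v y (rcons v' z)); rewrite def_w rcons_cat.
case/lastP: v' => [|v' z']; first by rewrite cats1 => /rcons_inj[<- <-]; apply: cz.
by rewrite -rcons_cons -rcons_cat => /rcons_inj[def_w _]; apply: cw def_w.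
Qed.

(** * Squeezing and stretching runs *)

(* Replaces the c-th occurrence (counted from 0) of each letter x of w by      *)
(* g x c copies of x; v is the part of the word already read.                  *)
Fixpoint respread_from (T : eqType) (g : T -> nat -> nat) (v w : seq T) :=
  if w is x :: w' then
    nseq (g x (count_mem x v)) x ++ respread_from g (rcons v x) w'
  else [::].

Definition respread (T : eqType) (g : T -> nat -> nat) (w : seq T) :=
  respread_from g [::] w.

Lemma respread_rcons (T : eqType) g (w : seq T) z :
  respread g (rcons w z) = respread g w ++ nseq (g z (count_mem z w)) z.
Proof.
rewrite /respread -[in count_mem z w](cat0s w).
elim: w [::] => [|x w IHw] v /=; first by rewrite !cats0.
by rewrite IHw catA cat_rcons.
Qed.

Lemma eq_respread (T : eqType) g g' (w : seq T) :
  (forall x c, c < count_mem x w -> g x c = g' x c) ->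
  respread g w = respread g' w.
Proof.
elim/last_ind: w => // w z IHw eq_g; rewrite !respread_rcons IHw => [|x c lt_c].
  by rewrite eq_g // -cats1 count_cat /= eqxx; lia.
by rewrite eq_g // -cats1 count_cat ltn_addr.
Qed.

Lemma respread_map (T U : eqType) (h : T -> U) g g' (w : seq T) :
  {in w &, injective h} -> (forall x c, x \in w -> g (h x) c = g' x c) ->
  respread g (map h w) = map h (respread g' w).
Proof.
elim/last_ind: w => // w z IHw inj_h eq_g.
have sub_w : {subset w <= rcons w z} by move=> x xw; rewrite mem_rcons inE xw orbT.
have z_w : z \in rcons w z by rewrite mem_rcons mem_head.
rewrite map_rcons !respread_rcons map_cat map_nseq IHw; last first.
- by move=> x c /sub_w; apply: eq_g.
- by move=> x y /sub_w xw /sub_w; apply: inj_h.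
rewrite eq_g // count_map; congr (_ ++ nseq (g' z _) _).
by apply: eq_in_count => x /sub_w xw /=; rewrite (inj_in_eq inj_h).
Qed.

Definition squeeze (T : eqType) p (e : T -> nat) : seq T -> seq T :=
  respread (fun x c => ~~ (p <= c < p + e x)).

(** Occurrences are numbered from 0, so [c.+1 == p] picks the p-th one. For p = 0 there is none,
    whence the hypothesis [0 < p] below. *)
Definition stretch (T : eqType) p (e : T -> nat) : seq T -> seq T :=
  respread (fun x c => (if c.+1 == p then e x else 0).+1).

Lemma squeeze_rcons (T : eqType) p e (w : seq T) z :
  squeeze p e (rcons w z) =
  if p <= count_mem z w < p + e z then squeeze p e w else rcons (squeeze p e w) z.
Proof.
by rewrite /squeeze respread_rcons; case: ifP => /=; rewrite ?cats0 ?cats1.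
Qed.

Lemma stretch_rcons (T : eqType) p e (w : seq T) z :
  stretch p e (rcons w z) =
  rcons (stretch p e w) z ++ nseq (if (count_mem z w).+1 == p then e z else 0) z.
Proof. by rewrite /stretch respread_rcons cat_rcons. Qed.

Lemma count_rcons (T : eqType) (x z : T) w :
  count_mem x (rcons w z) = (z == x) + count_mem x w.
Proof. by rewrite -cats1 count_cat /= addn0 addnC. Qed.

Lemma count_squeeze (T : eqType) p e (w : seq T) x :
  count_mem x (squeeze p e w) =
  minn (count_mem x w) p + (count_mem x w - (p + e x)).
Proof.
elim/last_ind: w => [|w z IHw]; first by rewrite /= min0n.
rewrite squeeze_rcons count_rcons fun_if count_rcons IHw.
by case: (eqVneq z x) => [->|_]; case: ifP; rewrite ?eqxx; lia.
Qed.

Lemma count_stretch (T : eqType) p e (w : seq T) x : 0 < p ->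
  count_mem x (stretch p e w) =
  count_mem x w + (if p <= count_mem x w then e x else 0).
Proof.
move=> p_gt0; elim/last_ind: w => [|w z IHw]; first by case: p p_gt0.
rewrite stretch_rcons count_cat !count_rcons IHw count_nseq /=.
by case: (eqVneq z x) => [->|_]; rewrite ?eqxx /=; do 3?case: ifP; lia.
Qed.

(** The inserted copies of x get exactly the numbers p to p + e x - 1 that [squeeze] deletes. *)
Lemma stretchK (T : eqType) p (e : T -> nat) : 0 < p ->
  cancel (stretch p e) (squeeze p e).
Proof.
move=> p_gt0; elim/last_ind=> // w z IHw; rewrite stretch_rcons.
have base : squeeze p e (rcons (stretch p e w) z) = rcons w z.
  by rewrite squeeze_rcons count_stretch // IHw; do 2?case: ifP => //; lia.
case: eqP => [cz|_]; last by rewrite cats0.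
have : e z <= e z by [].
(* Only the number of appended copies is generalized; the bound [e z] stays fixed. *)
elim: {1 3}(e z) => [|j IHj] lt_j; first by rewrite cats0.
rewrite -addn1 nseqD catA cats1 squeeze_rcons IHj ?(ltnW lt_j) //.
rewrite count_cat count_rcons count_stretch // count_nseq /= eqxx.
by rewrite ifT //; case: ifP; lia.
Qed.

(** Contiguity puts the deleted copies where [stretch] reinserts them; the condition on counts says
    that no run is cut short by the end of the word. *)
Lemma squeezeK (T : eqType) p (e : T -> nat) w : 0 < p ->
  contiguous p e w -> (forall x, ~~ (p <= count_mem x w < p + e x)) ->
  stretch p e (squeeze p e w) = w.
Proof.
move=> p_gt0 + inact; pose act v x := p <= count_mem x v < p + e x.
(* On a prefix v ending inside the run of x, the left-hand side has already    *)
(* output the whole run.                                                       *)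
have sqE v : contiguous p e v ->
  [/\ forall x, ~~ act v x & stretch p e (squeeze p e v) = v] \/
  exists2 x, act v x &
    stretch p e (squeeze p e v) = v ++ nseq (p + e x - count_mem x v) x.
  elim/last_ind: v => [_|v y IHv /contiguous_rcons[/IHv{}IHv act_y]].
    by left; split=> // x; rewrite /act /=; lia.
  have noact x : x != y -> ~~ act (rcons v y) x.
    move=> neq; apply/negP; rewrite /act count_rcons eq_sym (negPf neq).
    by move/act_y/eqP; apply/negP.
  rewrite squeeze_rcons; case: IHv => [[nact eqv]|[x act_x eqv]].
    rewrite -/(act v y) (negPf (nact y)) stretch_rcons eqv.
    move: (nact y); rewrite /act => nact_y.
    have [act'|nact'] := boolP (act (rcons v y) y).
      right; exists y => //; congr (_ ++ nseq _ y); move: act' nact_y.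
      by rewrite count_squeeze /act count_rcons eqxx; case: ifP; lia.
    left; split=> [x|].
      by case: (eqVneq x y) => [->|]; [exact: nact' | exact: noact].
    move: nact' nact_y; rewrite count_squeeze /act count_rcons eqxx.
    case: ifP => [|_ _ _]; last by rewrite cats0.
    move=> cy h1 h2; have -> : e y = 0 by move: cy h1 h2; clear; lia.
    by rewrite cats0.
  have def_y := act_y x act_x; subst x; rewrite -/(act v y) act_x eqv.
  have [act'|nact'] := boolP (act (rcons v y) y).
    right; exists y => //; rewrite cat_rcons -[y :: _]/(nseq _.+1 y).
    by congr (_ ++ nseq _ y); move: act' act_x; rewrite /act count_rcons eqxx; lia.
  left; split=> [x|].
    by case: (eqVneq x y) => [->|]; [exact: nact' | exact: noact].
  rewrite -cats1; congr (_ ++ _); rewrite -[[:: y]]/(nseq 1 y).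
  by congr nseq; move: nact' act_x; rewrite /act count_rcons eqxx; lia.
by case/sqE=> [[] //|[x]]; rewrite /act (negPf (inact x)).
Qed.

Lemma contiguous_stretch (T : eqType) p (e : T -> nat) w : 0 < p ->
  contiguous p e (stretch p e w).
Proof.
move=> p_gt0; elim/last_ind: w => [|w z IHw]; first by case.
rewrite stretch_rcons; set m := (if _ then _ else _); clearbody m.
rewrite cat_rcons -[z :: _]/(nseq m.+1 z).
elim: m.+1 => [|j IHj]; first by rewrite cats0.
rewrite -addn1 nseqD catA cats1; apply/contiguous_rcons; split=> // x.
rewrite count_cat count_nseq count_stretch //= eq_sym.
by case: eqVneq => //= _; case: ifP; lia.
Qed.

(** * Sliding the surplus copies *)

Definition slide (T : eqType) d p p' (w : seq T) : seq T :=
  stretch p' (excess d w) (squeeze p (excess d w) w).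

(** A letter with more than d copies keeps exactly d after squeezing, so its p'-th copy is still
    there to be stretched. *)
Lemma count_slide (T : eqType) d p p' (w : seq T) x : 0 < p' <= d -> p <= d ->
  count_mem x (slide d p p' w) = count_mem x w.
Proof.
move=> /andP[p'_gt0 le_p'd] le_pd.
rewrite /slide count_stretch // count_squeeze /excess.
by case: ifP; lia.
Qed.

Lemma perm_slide (T : eqType) d p p' (w : seq T) : 0 < p' <= d -> p <= d ->
  perm_eq (slide d p p' w) w.
Proof.
by move=> hp' hp; apply/allP => x _ /=; rewrite count_slide.
Qed.

Lemma slide_map (T U : eqType) (h : T -> U) d p p' (w : seq T) :
  {in w &, injective h} ->
  slide d p p' (map h w) = map h (slide d p p' w).
Proof.
move=> inj_h; have eq_e x : x \in w -> excess d (map h w) (h x) = excess d w x.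
  move=> xw; rewrite /excess count_map; congr (_ - _).
  by apply: eq_in_count => y yw /=; rewrite (inj_in_eq inj_h).
have sub : {subset squeeze p (excess d w) w <= w}.
  by move=> x; rewrite -!has_pred1 !has_count count_squeeze; lia.
have sqE : squeeze p (excess d (map h w)) (map h w) = map h (squeeze p (excess d w) w).
  by apply: respread_map => // x c xw; rewrite eq_e.
rewrite /slide sqE; apply: respread_map => [x y /sub xw /sub|x c /sub xw]; first exact: inj_h.
by rewrite eq_e.
Qed.

Lemma avoids_slide (T : eqType) d p p' q' (w : seq T) :
  0 < p' <= d -> p <= d -> p' + q' = d.+1 -> avoids p' q' (slide d p p' w).
Proof.
move=> hp' hp pq'; apply/(avoids_contiguous _ pq') => v y v' x def_w.
rewrite /excess count_slide //; apply: contiguous_stretch def_w.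
by case/andP: hp'.
Qed.

(** The slid word has the multiplicities of w, hence its excess, and squeezing it at p' undoes the
    stretch. *)
Lemma slide_inj_squeeze (T : eqType) d p p' (w1 w2 : seq T) :
  0 < p' <= d -> p <= d -> slide d p p' w1 = slide d p p' w2 ->
  (forall x, count_mem x w1 = count_mem x w2) /\
  squeeze p (excess d w1) w1 = squeeze p (excess d w1) w2.
Proof.
move=> hp' hp eqw.
have eq_c x : count_mem x w1 = count_mem x w2.
  by rewrite -(count_slide w1 x hp' hp) eqw count_slide.
have sqE w : (forall x, count_mem x w1 = count_mem x w) ->
    squeeze p (excess d w1) w = squeeze p' (excess d w1) (slide d p p' w).
  move=> eq_w; rewrite /slide.
  rewrite -[LHS](@stretchK _ p' (excess d w1)); last by case/andP: hp'.
  congr squeeze.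
  have -> : squeeze p (excess d w1) w = squeeze p (excess d w) w.
    by apply: eq_respread => x c _; rewrite /excess eq_w.
  by apply: eq_respread => x c _; rewrite /excess eq_w.
by split=> //; rewrite !sqE // eqw.
Qed.

Lemma slide_inj (T : eqType) d p q p' (w1 w2 : seq T) :
  0 < p <= d -> p + q = d.+1 -> 0 < p' <= d -> avoids p q w1 -> avoids p q w2 ->
  slide d p p' w1 = slide d p p' w2 -> w1 = w2.
Proof.
move=> /andP[p_gt0 hp] pq hp' /(avoids_contiguous _ pq) c1.
move=> /(avoids_contiguous _ pq) c2 /slide_inj_squeeze[] // eq_c eq_s.
rewrite -(squeezeK p_gt0 c1) => [|x]; last by rewrite /excess; lia.
rewrite eq_s squeezeK // => [v y v' x def_w|x]; last by rewrite /excess eq_c; lia.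
by rewrite /excess eq_c; apply: c2 def_w.
Qed.

(** * Surplus at the end of the word, and two frequent letters *)

(** After the (d+1)-st copy of a letter only that letter can follow. Squeezing at d keeps the first
    d copies of every letter. *)
Lemma avoids_tail (T : eqType) d (w : seq T) : avoids d.+1 0 w ->
  exists2 s, w = squeeze d (excess d w) w ++ s & {in s &, forall x y, x = y}.
Proof.
have -> : squeeze d (excess d w) w = respread (fun _ c => c < d) w.
  by apply: eq_respread => x c; rewrite /excess; lia.
(* The extra clause on frequencies forces s to be empty as long as the next letter has fewer than d
   copies. *)
move=> avw; suff [s [? _ ?]] : exists s, [/\ w = respread (fun _ c => c < d) w ++ s,
    {in s, forall x, d < count_mem x w} & {in s &, forall x y, x = y}] by exists s.
elim/last_ind: w avw => [_|w z IHw avw]; first by exists [::].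
have last_z x : d < count_mem x w -> x = z.
  by move=> lt_d; apply: (avw w z [::]); rewrite ?cats1.
case: IHw => [v y v' x def_w|s [def_w lt_s eq_s]].
  by move=> le_v _; apply: (avw v y (rcons v' z)); rewrite ?def_w ?rcons_cat.
have s_z x : x \in s -> x = z by move/lt_s/last_z.
rewrite respread_rcons; case: ltnP => [lt_z|le_z] /=.
  case: s def_w lt_s s_z {eq_s} => [|x s] def_w lt_s s_z.
    by exists [::]; split=> //; rewrite cats0 cats1; rewrite cats0 in def_w; rewrite -def_w.
  have xs := mem_head x s; have := lt_s x xs; rewrite (s_z x xs); lia.
exists (rcons s z); split.
- by rewrite cats0 -rcons_cat -def_w.
- move=> x; rewrite mem_rcons inE count_rcons => /predU1P[->|/lt_s]; rewrite ?eqxx; lia.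
- by move=> x y; rewrite !mem_rcons !inE => /predU1P[->|/s_z->] /predU1P[->|/s_z->].
Qed.

Lemma perm_eq_constant (T : eqType) (s1 s2 : seq T) :
  perm_eq s1 s2 -> {in s1 &, forall x y, x = y} -> s1 = s2.
Proof.
case: s1 => [|x s1] eq_s cst; first by apply/esym/nilP; rewrite /nilp -(perm_size eq_s).
have nseqE s : perm_eq (x :: s1) s -> s = nseq (size s) x.
  move=> eq_s'; apply/all_pred1P/allP => y; rewrite -(perm_mem eq_s') => ys.
  by rewrite /= (cst y x) // mem_head.
by rewrite (nseqE _ eq_s) -(perm_size eq_s); apply: nseqE.
Qed.

(** The squeezed prefixes agree, so the tails are permutations of each other; being constant, they
    coincide. *)
Lemma slide_inj_tail (T : eqType) d (w1 w2 : seq T) :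
  0 < d -> avoids d.+1 0 w1 -> avoids d.+1 0 w2 ->
  slide d d d w1 = slide d d d w2 -> w1 = w2.
Proof.
move=> d_gt0 /avoids_tail[s1 def1 cst1] /avoids_tail[s2 def2 _].
move/slide_inj_squeeze; rewrite d_gt0 leqnn => /(_ isT isT)[eq_c eq_s].
have eq_e : squeeze d (excess d w2) w2 = squeeze d (excess d w1) w2.
  by apply: eq_respread => x c _; rewrite /excess eq_c.
rewrite def1 def2 eq_e -eq_s; congr (_ ++ _); apply: perm_eq_constant cst1.
rewrite -(perm_cat2l (squeeze d (excess d w1) w1)) -def1 eq_s -eq_e -def2.
by apply/allP => x _ /=; rewrite eq_c.
Qed.

(** A letter with more than d copies must be the last letter of w. *)
Lemma avoids_last_uniq (T : eqType) d (w : seq T) x y :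
  avoids d.+1 0 w -> d < count_mem x w -> d < count_mem y w -> x = y.
Proof.
case/lastP: w => // w z avw.
have lastE t : d < count_mem t (rcons w z) -> t = z.
  rewrite count_rcons; case: (eqVneq z t) => [->|_] // lt_d.
  by apply: (avw w z [::]); rewrite ?cats1.
by move=> /lastE-> /lastE->.
Qed.

Lemma avoids_rev (T : eqType) p q (w : seq T) :
  avoids p q w -> avoids q p (rev w).
Proof.
move=> avw v y v' x def_w le_q le_p.
apply: (avw (rev v') y (rev v)); rewrite ?count_rev //.
by rewrite -[w]revK def_w rev_cat rev_cons cat_rcons.
Qed.

Lemma avoids_two_letters (T : eqType) d (x y : T) m :
  0 < d <= m -> x != y -> avoids d 1 (nseq m x ++ nseq d.+1 y).
Proof.
move=> /andP[d_gt0 le_dm] neq_xy; apply/(avoids_contiguous _ (addn1 d)).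
(* The run required of x is over before the first y. *)
have e_x : d + excess d (nseq m x ++ nseq d.+1 y) x <= m.
  by rewrite /excess count_cat !count_nseq /= eqxx eq_sym (negPf neq_xy); lia.
move: (excess _ _) e_x => e e_x.
elim: d.+1 => [|j IHj].
  rewrite cats0; elim: {1}m => [|i IHi]; first by case.
  rewrite -addn1 nseqD cats1; apply/contiguous_rcons; split=> // t.
  by rewrite count_nseq /=; case: eqVneq => //= _; lia.
rewrite -addn1 nseqD catA cats1; apply/contiguous_rcons; split=> [|t] //.
rewrite count_cat !count_nseq /=; case: (eqVneq y t) => //= _.
by case: eqVneq => [<-|_] /=; lia.
Qed.

(** * Standardization and containment of [beta k a] *)

Lemma enum_val_ltn (n : nat) (S : {set 'I_n}) (i j : 'I_#|S|) :
  ((enum_val i : 'I_n) < enum_val j) = (i < j).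
Proof.
have sortS : sorted (relpre val ltn) (enum S).
  rewrite /enum_mem -enumT; apply: sorted_filter; first by move=> x y z; apply: ltn_trans.
  by rewrite -sorted_map val_enum_ord iota_ltn_sorted.
have homo (i1 j1 : 'I_#|S|) : i1 < j1 -> (enum_val i1 : 'I_n) < enum_val j1.
  move=> lt_ij; pose x0 := enum_val i1; rewrite !(enum_val_nth x0).
  apply: (sorted_ltn_nth _ x0 sortS) => //; rewrite ?inE -?cardE //.
  by move=> x y z; apply: ltn_trans.
case: (ltngtP i j) => [/homo //|/homo|/val_inj->]; last by rewrite ltnn.
by rewrite ltnNge => /negbTE lt_ji; apply: contraFF lt_ji; apply: ltnW.
Qed.

Lemma card_enum_val_ltn (n : nat) (S : {set 'I_n}) (i : 'I_#|S|) :
  #|[set j in S | j < (enum_val i : 'I_n)]| = i.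
Proof.
transitivity #|[set t : 'I_#|S| | t < i]|.
  rewrite -(card_imset _ (@enum_val_inj _ (mem S))); apply: eq_card => j; rewrite !inE.
  apply/andP/imsetP => [[jS lt_j]|[t]]; last first.
    by rewrite inE => lt_t ->; rewrite enum_valP enum_val_ltn.
  exists (enum_rank_in jS j); last by rewrite enum_rankK_in.
  by rewrite inE -enum_val_ltn enum_rankK_in.
rewrite -sum1_card; under eq_bigl do rewrite inE.
by rewrite (big_ord_narrow (ltnW (ltn_ord i))) sum1_card card_ord.
Qed.

Lemma exists_subset_card (T : finType) (A : {set T}) m :
  m <= #|A| -> exists2 B : {set T}, B \subset A & #|B| = m.
Proof.
rewrite -bin_gt0 -cards_draws => /card_gt0P[B]; rewrite inE => /andP[sBA /eqP].
by exists B.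
Qed.

(** In an occurrence of [beta k a], c plays the singleton a and B contains the other k - 1
    elements. *)
Lemma contains_betaP (n k a : nat) (sigma : {set {set 'I_n}}) :
  1 < k -> 0 < a <= k -> partition sigma [set: 'I_n] ->
  contains sigma (beta k a) <-> exists c B, [/\ B \in sigma, c \notin B,
    a.-1 <= #|[set j in B | j < c]| & k - a <= #|[set j in B | c < j]|].
Proof.
move=> k_gt1 /andP[a_gt0 le_ak] part; split.
  case/existsP=> S /eqP eqS; have def_k : #|S| = k := congr1 tag eqS.
  subst k; have {}eqS := eq_from_Tagged eqS.
  have : [set i : 'I_#|S| | i.+1 != a] \in beta #|S| a by rewrite !inE eqxx.
  rewrite -eqS => /imsetP[_ /setD1P[_ /imsetP[B sB ->]] /setP def_B].
  have lt_a : a.-1 < #|S| by rewrite prednK.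
  have inB (i : 'I_#|S|) : (enum_val i \in B) = (i.+1 != a).
    by have:= def_B i; rewrite !inE enum_valP andbT.
  (* The a-th smallest element of S, with index a - 1 from 0. *)
  pose c : 'I_n := enum_val (Ordinal lt_a); exists c, B.
  have subB j : j \in S -> j != c -> j \in B.
    move=> jS; rewrite -(enum_rankK_in jS jS) inB; apply: contraNN => /eqP def_a.
    by apply/eqP; congr enum_val; apply: val_inj; rewrite /= -def_a.
  have card_lt : #|[set j in S | j < c]| = a.-1 by apply: card_enum_val_ltn.
  split=> //; first by rewrite inB /= prednK // eqxx.
    rewrite -card_lt; apply/subset_leq_card/subsetP => j; rewrite !inE => /andP[jS lt_jc].
    by rewrite lt_jc subB //; apply: contraTneq lt_jc => ->; rewrite ltnn.
  have -> : #|S| - a = #|[set j in S | c < j]|.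
    rewrite -(cardsID [set j : 'I_n | j < c] S) (cardsD1 c (S :\: _)) !inE ltnn enum_valP.
    have -> : S :&: [set j : 'I_n | j < c] = [set j in S | j < c].
      by apply/setP=> j; rewrite !inE.
    have -> : (S :\: [set j : 'I_n | j < c]) :\ c = [set j in S | c < j].
      apply/setP=> j; rewrite !inE -leqNgt (ltn_neqAle c j) eq_sym andbA.
      by rewrite andbC -val_eqE; case: (_ \in S).
    by rewrite card_lt addnA (addn1 a.-1) prednK // addKn.
  apply/subset_leq_card/subsetP => j; rewrite !inE => /andP[jS lt_jc].
  by rewrite lt_jc subB //; apply: contraTneq lt_jc => ->; rewrite ltnn.
case=> c [B [sB cB /exists_subset_card[L sL card_L] /exists_subset_card[R sR card_R]]].
have /and3P[_ /trivIsetP tI _] := part.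
have LB j : j \in L -> (j \in B) && (j < c) by move/(subsetP sL); rewrite inE.
have RB j : j \in R -> (j \in B) && (c < j) by move/(subsetP sR); rewrite inE.
pose M := L :|: R; have MB : M \subset B.
  by apply/subsetP => j /setUP[/LB|/RB] /andP[].
have cM : c \notin M by apply: contra cB; apply/subsetP.
have card_M : #|M| = k.-1.
  rewrite cardsU card_L card_R (_ : L :&: R = set0) ?cards0; first by lia.
  by apply/setP => j; rewrite !inE; apply/negP => /andP[/LB/andP[_ +] /RB/andP[_]]; lia.
(* L and R have exactly a - 1 and k - a elements, so c is the a-th smallest element of S. *)
pose S := c |: M; have def_k : k = #|S| by rewrite cardsU1 cM card_M; lia.
apply/existsP; exists S; apply/eqP; subst k; congr Tagged.
have cS : c \in S by rewrite setU11.
have rank_c (i : 'I_#|S|) : (enum_val i == c) = (i.+1 == a).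
  have rankE : #|[set j in S | j < c]| = a.-1.
    rewrite -card_L; apply: eq_card => j; rewrite !inE.
    apply/andP/idP=> [[]|jL]; last by rewrite jL orbT; case/andP: (LB j jL).
    case/predU1P => [->|/orP[//|/RB/andP[_ lt_cj]] lt_jc]; first by rewrite ltnn.
    by have := ltn_trans lt_cj lt_jc; rewrite ltnn.
  apply/eqP/eqP => [def_c|def_a]; first by rewrite -(card_enum_val_ltn i) def_c rankE prednK.
  rewrite -(enum_rankK_in cS cS); congr enum_val; apply: val_inj.
  by rewrite /= -(card_enum_val_ltn (enum_rank_in cS c)) enum_rankK_in // rankE -def_a.
have BS : B :&: S = M.
  apply/setP=> j; rewrite in_setI in_setU1; case: (eqVneq j c) => [->|_] /=.
    by rewrite (negPf cB) (negPf cM).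
  by apply/andb_idl/(subsetP MB).
(* The block of c meets S in c alone, because the rest of S lies in B. *)
have [C sC cC] : exists2 C, C \in sigma & c \in C.
  by exists (pblock sigma c); rewrite ?pblock_mem ?mem_pblock // (cover_partition part).
have neq_CB : C != B by apply: contraNneq cB => <-.
have CS : C :&: S = [set c].
  apply/setP=> j; rewrite in_setI in_setU1 in_set1; case: (eqVneq j c) => [->|_] /=.
    by rewrite cC.
  apply/negP=> /andP[jC /(subsetP MB) jB].
  by have /disjointFr/(_ jC) := tI _ _ sC sB neq_CB; rewrite jB.
have -> : restriction sigma S = [set M; [set c]].
  apply/setP=> X; rewrite in_setD1 in_set2; apply/andP/orP => [[X0 /imsetP[D sD def_X]]|].
    case/set0Pn: X0 => j; rewrite {X}def_X => /setIP[jD].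
    have eqD E : E \in sigma -> j \in E -> D = E.
      by move=> sE; apply: contraTeq => neq_DE; rewrite (disjointFr (tI D E sD sE neq_DE) jD).
    case/setU1P => [def_j|jM]; [right|left].
      by rewrite (eqD C) ?CS ?def_j.
    by rewrite (eqD B) ?BS // (subsetP MB).
  case=> /eqP->.
    by rewrite -card_gt0 card_M -ltnS prednK ?(ltnW k_gt1) //; split=> //; apply/imsetP; exists B.
  by rewrite -card_gt0 cards1; split=> //; apply/imsetP; exists C.
rewrite /standardization imsetU1 imset_set1 /beta; congr [set _; _].
  apply/setP=> i; rewrite !in_set -[i.+1 == a]rank_c -in_setU.
  have := enum_valP i; rewrite in_setU1.
  by case: eqP => [->|_] /=; rewrite ?(negPf cM).
by apply/setP=> i; rewrite !inE rank_c.
Qed.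

(** * Set partitions as kernels of words *)

Definition kernel (T : eqType) (x0 : T) (n : nat) (w : seq T) : {set {set 'I_n}} :=
  preim_partition (fun i : 'I_n => nth x0 w i) [set: 'I_n].

Lemma kernelP (T : eqType) (x0 : T) n (w : seq T) (B : {set 'I_n}) :
  reflect (exists i : 'I_n, B = [set j : 'I_n | nth x0 w i == nth x0 w j])
          (B \in kernel x0 n w).
Proof.
apply: (iffP imsetP) => [[i _ ->]|[i ->]]; exists i; rewrite ?inE //;
  by apply/setP => j; rewrite !inE.
Qed.

Lemma count_take_card (T : eqType) (x0 : T) n (w : seq T) x m :
  size w = n -> m <= n ->
  count_mem x (take m w) = #|[set j : 'I_n | (nth x0 w j == x) && (j < m)]|.
Proof.
move=> size_w le_mn; rewrite -sum1_count (big_nth x0) size_take size_w.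
have -> : (if m < n then m else n) = m by case: ltngtP le_mn.
rewrite -sum1_card; under [RHS]eq_bigl do rewrite inE.
rewrite (big_ord_narrow_cond le_mn) /= big_mkord.
by apply: eq_bigl => j; rewrite nth_take.
Qed.

Lemma card_kernel_block (T : eqType) (x0 : T) n (w : seq T) x :
  size w = n -> #|[set j : 'I_n | x == nth x0 w j]| = count_mem x w.
Proof.
move=> size_w; rewrite -[w in RHS]take_size size_w.
rewrite (count_take_card x0 _ size_w (leqnn n)).
by apply: eq_card => j; rewrite !inE ltn_ord andbT eq_sym.
Qed.

(** In [contains_betaP], c is the position of y and B the set of positions of x. *)
Lemma kernel_avoiders (T : eqType) (x0 : T) n k a (w : seq T) :
  1 < k -> 0 < a <= k -> size w = n ->
  kernel x0 n w \in avoiders n (beta k a) <-> avoids a.-1 (k - a) w.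
Proof.
move=> k_gt1 a_k size_w.
have part : partition (kernel x0 n w) [set: 'I_n] by apply: preim_partitionP.
have ctE := contains_betaP k_gt1 a_k part.
rewrite inE part /=.
have cardE v y v' x (c : 'I_n) : w = v ++ y :: v' -> size v = c -> x != y ->
  let B := [set j : 'I_n | nth x0 w j == x] in
  #|[set j in B | j < c]| = count_mem x v /\
  #|[set j in B | c < j]| = count_mem x v'.
- move=> def_w size_v neq_xy B.
  have cv : #|[set j in B | j < c]| = count_mem x v.
    transitivity (count_mem x (take c w)); last by rewrite def_w -size_v take_size_cat.
    by rewrite (count_take_card x0 _ size_w (ltnW (ltn_ord c))); apply: eq_card => j; rewrite !inE.
  split=> //; apply: (@addnI #|[set j in B | j < c]|).
  rewrite [in RHS]cv.
  have -> : count_mem x v + count_mem x v' = count_mem x (take n w).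
    by rewrite take_oversize ?size_w // def_w count_cat /= eq_sym (negPf neq_xy).
  have c_y : nth x0 w c = y by rewrite def_w -size_v nth_cat ltnn subnn.
  rewrite (count_take_card x0 _ size_w (leqnn n)) -[RHS](cardsID [set j : 'I_n | j < c]).
  congr (_ + _); apply: eq_card => j; rewrite !inE ltn_ord andbT //.
  rewrite -leqNgt andbC (leq_eqVlt c).
  case: (eqVneq (c : nat) j) => //= eq_cj.
  by rewrite -eq_cj ltnn /= c_y eq_sym (negPf neq_xy).
split=> [/negP nct v y v' x def_w le_p le_q|avw].
  have [//|neq_xy] := eqVneq x y; case: nct; apply/ctE.
  have lt_v : size v < n by rewrite -size_w def_w size_cat /=; lia.
  have [cv cv'] := cardE v y v' x (Ordinal lt_v) def_w erefl neq_xy.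
  exists (Ordinal lt_v), [set j : 'I_n | nth x0 w j == x]; rewrite cv cv'; split=> //.
    have xw : x \in w.
      rewrite -has_pred1 has_count def_w count_cat /= eq_sym (negPf neq_xy); lia.
    have lt_x : index x w < n by rewrite -size_w index_mem.
    apply/kernelP; exists (Ordinal lt_x); apply/setP => j.
    by rewrite !inE /= nth_index // eq_sym.
  by rewrite inE /= def_w nth_cat ltnn subnn /= eq_sym.
apply/negP=> /ctE[c [B [/kernelP[i ->] cB le_p le_q]]].
have def_w : w = take c w ++ nth x0 w c :: drop c.+1 w.
  by rewrite -drop_nth ?cat_take_drop // size_w.
have size_t : size (take c w) = c by rewrite size_takel // size_w ltnW.
have neq : nth x0 w i != nth x0 w c by rewrite inE in cB.
have eqB : [set j : 'I_n | nth x0 w i == nth x0 w j] = [set j : 'I_n | nth x0 w j == nth x0 w i].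
  by apply/setP => j; rewrite !inE eq_sym.
have [cv cv'] := cardE _ _ _ _ c def_w size_t neq.
rewrite eqB cv in le_p; rewrite eqB cv' in le_q.
by case/eqP: neq; apply: avw def_w le_p le_q.
Qed.

(** The relabelling sends y to the letter of w1 at the first position of y in w2. *)
Lemma eq_kernel (T : eqType) (x0 : T) n (w1 w2 : seq T) :
  size w1 = n -> size w2 = n -> kernel x0 n w1 = kernel x0 n w2 ->
  exists2 h : T -> T, {in w2 &, injective h} & w1 = map h w2.
Proof.
move=> s1 s2 eqK.
have eq_nth (i j : nat) : i < n -> j < n ->
    (nth x0 w1 i == nth x0 w1 j) = (nth x0 w2 i == nth x0 w2 j).
  move=> lt_i lt_j; pose i' := Ordinal lt_i; pose j' := Ordinal lt_j.
  have kE w : (nth x0 w i == nth x0 w j) = (j' \in pblock (kernel x0 n w) i').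
    rewrite pblock_equivalence_partition ?inE //.
    by move=> x y z _ _ _; split=> // /eqP->.
  by rewrite !kE eqK.
have idx y : y \in w2 -> index y w2 < n by rewrite -s2 index_mem.
exists (fun y => nth x0 w1 (index y w2)) => [y z yw zw /eqP|].
  by rewrite eq_nth ?idx // !nth_index // => /eqP.
apply: (@eq_from_nth _ x0) => [|i]; rewrite ?size_map ?s1 ?s2 // => lt_i.
have iw : nth x0 w2 i \in w2 by rewrite mem_nth // s2.
rewrite (nth_map x0) ?s2 //; apply/eqP.
by rewrite eq_nth ?idx // nth_index.
Qed.

Lemma kernel_map (T : eqType) (x0 : T) n (h : T -> T) (w : seq T) :
  size w = n -> {in w &, injective h} -> kernel x0 n (map h w) = kernel x0 n w.
Proof.
move=> size_w inj_h; apply: eq_in_imset => i _; apply/setP => j; rewrite !inE.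
by rewrite !(nth_map x0) ?size_w // (inj_in_eq inj_h) // mem_nth ?size_w.
Qed.

Definition block_word n (sigma : {set {set 'I_n}}) : seq {set 'I_n} :=
  map (pblock sigma) (enum 'I_n).

Lemma size_block_word n (sigma : {set {set 'I_n}}) : size (block_word sigma) = n.
Proof. by rewrite size_map size_enum_ord. Qed.

Lemma kernel_block_word n (sigma : {set {set 'I_n}}) :
  partition sigma [set: 'I_n] -> kernel set0 n (block_word sigma) = sigma.
Proof.
move=> part; rewrite -[RHS](preim_partition_pblock part).
have nthE (i : 'I_n) : nth set0 (block_word sigma) i = pblock sigma i.
  by rewrite (nth_map i) ?size_enum_ord // nth_ord_enum.
by apply: eq_imset => i; apply/setP => j; rewrite !inE !nthE.
Qed.

(* The letters of f (block_word sigma) are blocks of sigma, not of its kernel; *)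
(* equivariance of f under relabelling makes up for the difference.            *)
Lemma leq_card_kernel n (A B : {set {set {set 'I_n}}})
    (f : seq {set 'I_n} -> seq {set 'I_n}) :
  (forall sigma, sigma \in A -> partition sigma [set: 'I_n]) ->
  (forall w, perm_eq (f w) w) ->
  (forall (h : {set 'I_n} -> {set 'I_n}) (w : seq {set 'I_n}),
     {in w &, injective h} -> f (map h w) = map h (f w)) ->
  (forall w : seq {set 'I_n}, size w = n -> kernel set0 n w \in A -> kernel set0 n (f w) \in B) ->
  (forall w1 w2 : seq {set 'I_n}, size w1 = n -> size w2 = n -> kernel set0 n w1 \in A ->
     kernel set0 n w2 \in A -> f w1 = f w2 -> w1 = w2) ->
  #|A| <= #|B|.
Proof.
move=> partA perm_f map_f AB inj_f.
pose F sigma := kernel set0 n (f (block_word sigma)).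
have size_w := @size_block_word n.
have kA sigma : sigma \in A -> kernel set0 n (block_word sigma) = sigma.
  by move/partA/kernel_block_word.
have inj_F : {in A &, injective F}.
  move=> sigma tau sA tA /eq_kernel; rewrite !(perm_size (perm_f _)).
  move=> /(_ (size_w _) (size_w _))[h inj_h eq_w].
  have {}inj_h : {in block_word tau &, injective h}.
    by move=> x y xw yw; apply: inj_h; rewrite (perm_mem (perm_f _)).
  (* By equivariance both sides are now values of f, at the word of sigma and at a relabelled word
     of tau whose kernel is still tau. *)
  rewrite -map_f // in eq_w.
  rewrite -(kA sigma) // -(kA tau) // -(kernel_map _ (size_w tau) inj_h); congr kernel.
  by apply: inj_f; rewrite ?(size_map h) ?size_w ?(kernel_map _ (size_w tau) inj_h) ?kA.
rewrite -(card_in_imset inj_F); apply/subset_leq_card/subsetP => _ /imsetP[sigma sA ->].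
by apply: AB; rewrite ?kA.
Qed.

(** * Comparing the numbers of avoiders *)

Lemma avoiders_partition n k (tau : {set {set 'I_k}}) sigma :
  sigma \in avoiders n tau -> partition sigma [set: 'I_n].
Proof. by rewrite inE => /andP[]. Qed.

(** The bounds place a - 1 and b - 1 between 1 and d = k - 2, as [slide] requires; exchanging a and
    b gives equality. *)
Lemma leq_avoiders_middle n k a b : 2 <= a <= k - 1 -> 2 <= b <= k - 1 ->
  #|avoiders n (beta k a)| <= #|avoiders n (beta k b)|.
Proof.
move=> ha hb; have k_gt1 : 1 < k by lia.
have [ha' hb'] : 0 < a <= k /\ 0 < b <= k by lia.
have [pa pb] : a.-1 + (k - a) = (k - 2).+1 /\ b.-1 + (k - b) = (k - 2).+1 by lia.
have [da db] : 0 < a.-1 <= k - 2 /\ 0 < b.-1 <= k - 2 by lia.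
have dpa : a.-1 <= k - 2 by lia.
apply: (@leq_card_kernel n _ _ (slide (k - 2) a.-1 b.-1)).
- exact: avoiders_partition.
- by move=> w; apply: perm_slide.
- by move=> h w; apply: slide_map.
- move=> w size_w _; apply/kernel_avoiders => //; last exact: avoids_slide.
  by rewrite (perm_size (perm_slide w db dpa)).
move=> w1 w2 size1 size2 /kernel_avoiders av1 /kernel_avoiders av2.
by apply: (slide_inj da pa db); [apply: av1 | apply: av2].
Qed.

Lemma leq_avoiders_rev n k a b : 1 < k -> 0 < a <= k -> a + b = k.+1 ->
  #|avoiders n (beta k a)| <= #|avoiders n (beta k b)|.
Proof.
move=> k_gt1 ha hab; have hb : 0 < b <= k by lia.
have [eb ea] : b.-1 = k - a /\ k - b = a.-1 by lia.
apply: (@leq_card_kernel n _ _ rev).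
- exact: avoiders_partition.
- by move=> w; rewrite perm_rev.
- by move=> h w _; rewrite map_rev.
- move=> w size_w /kernel_avoiders avw; apply/kernel_avoiders; rewrite ?size_rev //.
  by rewrite eb ea; apply/avoids_rev/avw.
by move=> w1 w2 _ _ _ _; apply: (inv_inj (@revK _)).
Qed.

(** The removed partitions have two blocks of size > k - 2. Block sizes are multiplicities, which
    [slide] preserves, so its image contains none of them. *)
Lemma leq_avoiders_tail n k : 3 <= k ->
  #|avoiders n (beta k k)| <= #|avoiders n (beta k (k - 1)) :\:
      [set sigma : {set {set 'I_n}} |
        [exists B : {set 'I_n} in sigma, exists C : {set 'I_n} in sigma,
         [&& B != C, k - 2 < #|B| & k - 2 < #|C|]]]|.
Proof.
move=> hk; have [hk1 hk'] : 0 < k <= k /\ 0 < k - 1 <= k by lia.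
have k_gt1 : 1 < k by lia.
have d_gt0 : 0 < k - 2 <= k - 2 by lia.
have [pk [pk' dk]] : k.-1 = (k - 2).+1 /\ (k - 1).-1 = k - 2 /\ k - (k - 1) = 1 by lia.
apply: (@leq_card_kernel n _ _ (slide (k - 2) (k - 2) (k - 2))).
- exact: avoiders_partition.
- by move=> w; apply: perm_slide.
- by move=> h w; apply: slide_map.
- move=> w size_w /(kernel_avoiders _ k_gt1 hk1 size_w); rewrite pk subnn => avw.
  have size_s : size (slide (k - 2) (k - 2) (k - 2) w) = n.
    by rewrite (perm_size (perm_slide w d_gt0 _)).
  rewrite in_setD andbC; apply/andP; split.
    apply/kernel_avoiders => //; rewrite pk' dk.
    by apply: avoids_slide => //; rewrite addn1.
  rewrite inE; apply/existsP => [[B /andP[/kernelP[i ->]]]].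
  case/existsP => [C /andP[/kernelP[j ->] /and3P[neq]]].
  rewrite !(card_kernel_block set0 _ size_s) !count_slide // => hi hj.
  case/eqP: neq.
  by rewrite (avoids_last_uniq avw hi hj).
move=> w1 w2 size1 size2 /(kernel_avoiders _ k_gt1 hk1 size1); rewrite pk subnn => av1.
move=> /(kernel_avoiders _ k_gt1 hk1 size2); rewrite pk subnn => av2.
by apply: slide_inj_tail; case/andP: d_gt0.
Qed.

Lemma ltn_avoiders_tail n k : 3 <= k -> 2 * k - 2 <= n ->
  #|avoiders n (beta k k)| < #|avoiders n (beta k (k - 1))|.
Proof.
move=> hk hn; apply: leq_ltn_trans (leq_avoiders_tail n hk) _.
apply/proper_card/properP; split; first exact: subsetDl.
(* From n >= 2k - 2 follows m >= k - 1, so both letters occur more than k - 2 times. Any two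
   distinct letters would do. *)
pose m := n - (k - 1); pose x : {set 'I_n} := set0; pose y : {set 'I_n} := setT.
have n_gt0 : 0 < n by lia.
have neq_xy : x != y by rewrite eq_sym; apply/set0Pn; exists (Ordinal n_gt0); rewrite inE.
pose w := nseq m x ++ nseq (k - 2).+1 y.
have size_w : size w = n by rewrite size_cat !size_nseq /m; lia.
exists (kernel set0 n w).
  apply/kernel_avoiders => //; [lia|lia|].
  have [-> ->] : (k - 1).-1 = k - 2 /\ k - (k - 1) = 1 by lia.
  by apply: avoids_two_letters => //; rewrite /m; lia.
rewrite !inE negb_and negbK; apply/orP; left.
have blockE z : z \in w -> [set t : 'I_n | z == nth set0 w t] \in kernel set0 n w.
  move=> zw; have lt_z : index z w < n by move: zw; rewrite -index_mem size_w.
  by apply/kernelP; exists (Ordinal lt_z); rewrite /= nth_index.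
have cx : k - 2 < count_mem x w.
  by rewrite count_cat !count_nseq /= eqxx eq_sym (negPf neq_xy) /m; lia.
have cy : k - 2 < count_mem y w.
  by rewrite count_cat !count_nseq /= eqxx (negPf neq_xy); lia.
have inw z : k - 2 < count_mem z w -> z \in w.
  by move=> cz; rewrite -has_pred1 has_count; apply: leq_ltn_trans cz.
apply/existsP; exists [set t : 'I_n | x == nth set0 w t].
rewrite blockE ?inw //; apply/existsP; exists [set t : 'I_n | y == nth set0 w t].
rewrite blockE ?inw // !(card_kernel_block set0 _ size_w) cx cy !andbT /=.
have lt_x : index x w < n by move: (inw x cx); rewrite -index_mem size_w.
apply/negP => /eqP/setP/(_ (Ordinal lt_x)); rewrite !inE /= nth_index ?inw //.
by rewrite eqxx eq_sym (negPf neq_xy).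
Qed.

Theorem theorem2p1 (k : nat) (hk : 3 <= k) :
  [/\ (* (i) *)
      wilf_equiv (beta k 1) (beta k k),
      (* (ii) *)
      (forall n a : nat, k < n -> 2 <= a <= k - 1 ->
         #|avoiders n (beta k a.+1)| <= #|avoiders n (beta k a)| /\
         (a < k - 1 ->
            #|avoiders n (beta k a.+1)| = #|avoiders n (beta k a)|)) /\
      (forall a b : nat, 2 <= a <= k - 1 -> 2 <= b <= k - 1 ->
         wilf_equiv (beta k a) (beta k b))
    & (* (iii) *)
      (forall n : nat, 2 * k - 2 <= n ->
         #|avoiders n (beta k k)| < #|avoiders n (beta k (k - 1))|) /\
      (forall a : nat, 2 <= a <= k - 1 ->
         wilf_prec (beta k k) (beta k a))].
Proof.
(* As k - 1 is itself a middle index, comparisons with [beta k (k - 1)] extend to every middle a. *)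
have hk1 : 2 <= k - 1 <= k - 1 by lia.
have mid n a b : 2 <= a <= k - 1 -> 2 <= b <= k - 1 ->
    #|avoiders n (beta k a)| = #|avoiders n (beta k b)|.
  move=> ha hb.
  by apply: anti_leq; rewrite (leq_avoiders_middle n ha hb); apply: leq_avoiders_middle.
have tail n : #|avoiders n (beta k k)| <= #|avoiders n (beta k (k - 1))|.
  by apply: leq_trans (leq_avoiders_tail n hk) _; apply/subset_leq_card/subsetDl.
have k_gt1 : 1 < k by apply: ltnW.
have k_gt0 := ltnW k_gt1.
split.
- move=> n _; apply/eqP.
  have h1 : 0 < 1 <= k by [].
  have hkk : 0 < k <= k by rewrite k_gt0 leqnn.
  by rewrite eqn_leq (leq_avoiders_rev n k_gt1 h1 (add1n k))
    (leq_avoiders_rev n k_gt1 hkk (addn1 k)).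
- split=> [n a _ ha|a b ha hb n _]; last exact: mid.
  have [lt_a|ge_a] := ltnP a (k - 1).
    have ha' : 2 <= a.+1 <= k - 1 by lia.
    have eq_a := mid n _ _ ha' ha.
    by split=> [|_]; [apply: eq_leq eq_a | apply: eq_a].
  split=> [|//].
  have -> : a.+1 = k by lia.
  have -> : a = k - 1 by lia.
  exact: tail.
split=> [n|a ha]; first exact: ltn_avoiders_tail.
split=> [n _|]; first by rewrite (mid n _ _ ha hk1); apply: tail.
exists (2 * k - 2); split=> [|n /ltnW le_n]; first by lia.
by rewrite (mid n _ _ ha hk1); apply: ltn_avoiders_tail.
Qed.
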